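(* Let $m,n$ be positive integers with $m$ even, and let $w=\exp(2\pi i/(2m))$. For $\varepsilon=(\varepsilon_1,\ldots,\varepsilon_{m-1})\in\{\pm1\}^{m-1}$ let $\mathrm{sign}(\varepsilon)=1$ if the number of entries equal to $-1$ is even and $-1$ otherwise. Then $$\zeta(\{2m\}^n)=\frac{(-1)^{n+1+\frac m2}\pi^{2mn}}{2^{m-2}(2mn+m)!}\cdot\Im\left(\sum_{\substack{\varepsilon\in\{\pm1\}^{m-1}\\ \mathrm{sign}(\varepsilon)=1}}\left(w^{m-1}+\varepsilon_1w^{m-2}+\cdots+\varepsilon_{m-2}w+\varepsilon_{m-1}\right)^{2mn+m}\right).$$
   Context: $\zeta(\{2m\}^n)=\sum_{1\leq k_1<\cdots<k_n}(k_1k_2\cdots k_n)^{-2m}$; $\Im$ denotes imaginary part. *)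

(* Defs.v *)
From HB Require Import structures.
From mathcomp Require Import all_boot all_order all_algebra.
From mathcomp Require Import all_classical all_reals all_analysis.
From mathcomp Require Import complex.

Set Implicit Arguments.
Unset Strict Implicit.
Unset Printing Implicit Defensive.

Import Order.TTheory GRing.Theory Num.Theory.

Local Open Scope classical_set_scope.
Local Open Scope ring_scope.
Local Open Scope complex_scope.

(* The sum ranges over 1 <= k_1 < ... < k_n, encoded as [path ltn 0 k].
   It is taken in [\bar R], so an equality with some [x%:E] also asserts
   that the series of nonnegative terms converges. *)
Definition zeta_rep (R : realType) (a n : nat) : \bar R :=
  \esum_(k in [set k : n.-tuple nat | path ltn 0%N k])
    ((\prod_(j <- k) (j%:R : R)) ^- a)%:E.

Definition expC (R : realType) (z : R[i]) : R[i] :=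
  (expR (complex.Re z))%:C * (cos (complex.Im z) +i* sin (complex.Im z)).

Definition root_w (R : realType) (m : nat) : R[i] :=
  expC ((2 * pi)%:C * (0 +i* 1) / (2 * m)%:R).

(* An element of {+1, -1}^d is encoded as a boolean vector: [true] stands
   for the entry -1, [false] for the entry +1. *)
Definition signs (d : nat) := {ffun 'I_d -> bool}.

Definition entry (R : realType) (d : nat) (e : signs d) (j : 'I_d) : R[i] :=
  if e j then -1 else 1.

Definition sign_prod (d : nat) (e : signs d) : int :=
  if odd #|[set j | e j]%SET| then -1 else 1.

(* w^(m-1) + eps_1 w^(m-2) + ... + eps_(m-2) w + eps_(m-1); the index j is
   0-based, so [entry e j] is eps_(j+1), the coefficient of
   w^(m-1-(j+1)) = w^(m-2-j). *)
Definition signed_sum (R : realType) (m : nat) (e : signs m.-1) : R[i] :=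
  root_w R m ^+ (m - 1) +
  \sum_(j < m.-1) entry R e j * root_w R m ^+ (m - 2 - j).

(* Main.v *)
(* The sine product is only used at a finite level.  For M = 2p+1,
   (1 + 'i x)^M - (1 - 'i x)^M = 2 'i M x prod_(1 <= k <= p) (1 - c_k^2 x^2)
   with c_k = cot (k pi / M).  Taking the product over x := w^j x for j < m, with
   w^2 a primitive m-th root of unity, leaves a multiple of
   x^m prod_k (1 - c_k^(2m) x^(2m)) on the right, while expanding the left gives
   a signed sum over eps in {+-1}^m of M-th powers of the polynomials
   prod_j (1 + 'i eps_j w^j x).  Compare the coefficients of x^(2mn+m) and let p
   tend to infinity: as 'C(M, l) / M^N tends to 0 for l < N and to 1/N! for l = N,
   the left becomes a signed sum of powers of sum_j eps_j w^j; as
   (pi / M) c_k is at most 1/k and tends to 1/k, the elementary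
   symmetric function on the right becomes zeta({2m}^n).  Finally, multiplying
   by w rotates the sign vectors and flips their parity while w^(2mn+m) = -1, so
   only even sign vectors are needed. *)

Require Import Defs.
From HB Require Import structures.
From mathcomp Require Import all_boot all_order all_algebra.
From mathcomp Require Import all_classical all_reals all_analysis.
From mathcomp Require Import complex.
From mathcomp Require Import ring lra zify.

Import Order.TTheory GRing.Theory Num.Theory.
Import numFieldNormedType.Exports.

Local Open Scope ring_scope.

Section FiniteSineProduct.
Local Open Scope classical_set_scope.
Local Open Scope ring_scope.

(** * Polynomial identities *)

(** In characteristic zero the naturals below the size of [p - q] are already more distinct roots
    than a nonzero difference could have. *)
Lemma horner_poly_inj (F : numDomainType) (p q : {poly F}) :
  (forall x, p.[x] = q.[x]) -> p = q.
Proof.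
move=> pq; apply/eqP; rewrite -subr_eq0; apply/eqP.
apply: (@roots_geq_poly_eq0 _ _ [seq i%:R | i <- iota 0 (size (p - q))]).
- by apply/allP => x _; rewrite /root !hornerE pq subrr.
- by rewrite map_inj_uniq ?iota_uniq //; apply: mulrIn; rewrite oner_eq0.
- by rewrite size_map size_iota.
Qed.

Lemma poly_coef0_eq0 (F : comNzRingType) (g : {poly F}) :
  g`_0 = 0 -> g = drop_poly 1 g * 'X.
Proof.
move=> g0; rewrite -[LHS](poly_take_drop 1) expr1 (_ : take_poly 1 _ = 0) ?add0r //.
by apply/polyP => -[|i]; rewrite coef_take_poly coef0.
Qed.

Lemma coef_exp_small (F : comNzRingType) (g : {poly F}) (N l : nat) :
  g`_0 = 0 -> (N < l)%N -> (g ^+ l)`_N = 0.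
Proof. by move=> /poly_coef0_eq0 -> Nl; rewrite exprMn coefMXn Nl. Qed.

Lemma coef_exp_diag (F : comNzRingType) (g : {poly F}) (N : nat) :
  g`_0 = 0 -> (g ^+ N)`_N = g`_1 ^+ N.
Proof.
move=> /poly_coef0_eq0 {1}->; rewrite exprMn coefMXn ltnn subnn.
by rewrite -horner_coef0 horner_exp horner_coef0 coef_drop_poly.
Qed.

(** Expand [(1 + (g - 1)) ^+ M]. Since [g - 1] has no constant term, its powers beyond [N] do not
    reach ['X^N]. The range of summation thus becomes independent of [M], which later permits a
    termwise limit in [M]. *)
Lemma coef_exp_binomial (F : comNzRingType) (g : {poly F}) (M N : nat) : g`_0 = 1 ->
  (g ^+ M)`_N = \sum_(l < N.+1) ('C(M, l))%:R * ((g - 1) ^+ l)`_N.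
Proof.
move=> g0; have h0 : (g - 1)`_0 = 0 by rewrite coefB g0 coefC subrr.
rewrite -[in LHS](subrK 1 g) addrC exprDn coef_sum.
under eq_bigr do rewrite expr1n mul1r coefMn -mulr_natl.
pose G l := ('C(M, l))%:R * ((g - 1) ^+ l)`_N.
rewrite -(big_mkord xpredT G) -[RHS](big_mkord xpredT G).
have GN k : (N < k)%N -> G k = 0 by move=> Nk; rewrite /G coef_exp_small ?mulr0.
have GM k : (M < k)%N -> G k = 0 by move=> Mk; rewrite /G bin_small ?mul0r.
(* Either range may be the longer one: past [M] the binomial vanishes, past [N] the coefficient
   does. *)
have [MN|NM] := leqP M N.
  rewrite [RHS](@big_cat_nat _ _ _ M.+1) //= [X in _ = _ + X]big1_seq ?addr0 // => k.
  by rewrite mem_index_iota => /andP[_ /andP[/GM]].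
rewrite [LHS](@big_cat_nat _ _ _ N.+1) //= ?ltnS 1?ltnW // [X in _ + X]big1_seq ?addr0 // => k.
by rewrite mem_index_iota => /andP[_ /andP[/GN]].
Qed.

Lemma prod_scaleV (F : fieldType) (I : Type) (r : seq I) (c : I -> F) (x : F) : x != 0 ->
  \prod_(i <- r) (1 - c i * x) = x ^+ size r * \prod_(i <- r) (x^-1 - c i).
Proof.
move=> x0; elim: r => [|i r IH]; first by rewrite !big_nil expr0 mulr1.
by rewrite !big_cons IH exprS; field.
Qed.

(** This is the factorization of ['X^m - 1] evaluated at [x^-1], which leaves [x = 0] to be treated
    apart. *)
Lemma prod_1Bunity (F : fieldType) (m : nat) (z x : F) : m.-primitive_root z ->
  \prod_(j < m) (1 - z ^+ j * x) = 1 - x ^+ m.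
Proof.
move=> zP; have m0 := prim_order_gt0 zP.
have [->|x0] := eqVneq x 0.
  by rewrite big1 ?expr0n ?gtn_eqF ?subr0 // => i _; rewrite mulr0 subr0.
rewrite -(big_mkord xpredT (fun j => 1 - z ^+ j * x)) prod_scaleV // size_iota subn0.
have /(congr1 (horner^~ x^-1)) := factor_Xn_sub_1 zP.
rewrite horner_prod !hornerE; under eq_bigr do rewrite !hornerE.
by move=> ->; rewrite mulrBr mulr1 -exprMn mulfV // expr1n.
Qed.

Lemma prod_root_poly (F : fieldType) (p : {poly F}) (rs : seq F) (x : F) :
  size p = (size rs).+1 -> all (root p) rs -> uniq rs ->
  p.[x] = lead_coef p * \prod_(c <- rs) (x - c).
Proof.
move=> sp rt us; rewrite [in LHS](@all_roots_prod_XsubC _ p rs) ?uniq_rootsE //.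
by rewrite hornerZ horner_prod; under eq_bigr do rewrite !hornerE.
Qed.

(** * Roots of unity and cotangents *)

Section Cis.
Variable R : realType.
Local Notation C := R[i].
Local Open Scope complex_scope.

Definition cis (t : R) : C := cos t +i* sin t.

Lemma cisD (s t : R) : cis (s + t) = cis s * cis t.
Proof. by rewrite /cis cosD sinD (addrC (sin s * _)). Qed.

Lemma cis_expn (t : R) (n : nat) : cis t ^+ n = cis (n%:R * t).
Proof.
elim: n => [|n IH]; first by rewrite mul0r /cis cos0 sin0.
by rewrite exprS IH -cisD mulrSr addrC mulrDl mul1r.
Qed.

Lemma cis_pi : cis pi = -1.
Proof. by apply/eqP; rewrite eq_complex /= cospi sinpi oppr0 !eqxx. Qed.

Lemma cis_pihalf : cis (pi / 2) = 'i%C.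
Proof. by rewrite /cis cos_pihalf sin_pihalf. Qed.

Lemma root_wE (m : nat) : (0 < m)%N -> root_w R m = cis (pi / m%:R).
Proof.
move=> m0; have mC : (m%:R : R) != 0 by rewrite pnatr_eq0 -lt0n.
rewrite /root_w /expC.
have -> : (2 * pi)%:C * (0 +i* 1) / (2 * m)%:R = 0 +i* (pi / m%:R) :> C.
  have -> : (2 * m)%:R = (2 * m%:R)%:C :> C by rewrite rmorphM /= !rmorph_nat natrM.
  rewrite -(rmorphV _ (_ : _ \is a GRing.unit)); last first.
    by rewrite unitfE mulf_neq0 // pnatr_eq0.
  apply/eqP; rewrite eq_complex /=; apply/andP; split; apply/eqP; field => //.
by rewrite /= expR0 mul1r.
Qed.

Lemma root_w_expm (m : nat) : (0 < m)%N -> root_w R m ^+ m = -1.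
Proof.
move=> m0; rewrite root_wE // cis_expn mulrC divfK ?cis_pi //.
by rewrite pnatr_eq0 -lt0n.
Qed.

Lemma root_w_half (m : nat) : (0 < m)%N -> ~~ odd m -> root_w R m ^+ m./2 = 'i%C.
Proof.
move=> m0 me; rewrite root_wE // cis_expn -cis_pihalf; congr cis.
have mC : (m%:R : R) != 0 by rewrite pnatr_eq0 -lt0n.
have h : m%:R = 2 * (m./2)%:R :> R.
  by rewrite -natrM mul2n -[LHS]/(m%:R) -{1}(odd_double_half m) (negbTE me).
by rewrite h in mC *; field; move: mC; rewrite mulf_eq0 negb_or => /andP[].
Qed.

Lemma root_w_prim (m : nat) : (0 < m)%N -> m.-primitive_root (root_w R m ^+ 2).
Proof.
move=> m0; rewrite root_wE //.
apply/andP; split=> //; apply/forallP => /= i; apply/eqP.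
have mC : (m%:R : R) != 0 by rewrite pnatr_eq0 -lt0n.
rewrite unity_rootE -exprM cis_expn.
have [->|im] := eqVneq i.+1 m.
  apply/eqP; rewrite natrM.
  have -> : 2 * m%:R * (pi / m%:R) = pi + pi :> R by field.
  by rewrite cisD cis_pi mulrNN mulr1.
(* Half the angle of the power. It lies strictly between 0 and [pi], whereas a power equal to 1
   would give [cos (t + t) = 1], that is [sin t = 0]. *)
apply/negP => /eqP; set t := (i.+1%:R * (pi / m%:R) : R).
have -> : (2 * i.+1)%:R * (pi / m%:R) = t + t by rewrite /t natrM; field.
have t0 : 0 < t by rewrite /t mulr_gt0 ?divr_gt0 ?pi_gt0 ?ltr0n.
have tpi : t < pi.
  rewrite /t mulrCA gtr_pMr ?pi_gt0 // ltr_pdivrMr ?ltr0n // mul1r ltr_nat.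
  by rewrite ltn_neqAle im /=.
have st : 0 < sin t by apply: sin_gt0_pi; rewrite t0.
move=> [+ _]; rewrite cosD -!expr2 cos2sin2 => h.
have : sin t ^+ 2 = 0 by lra.
by move/eqP; rewrite sqrf_eq0 gt_eqF.
Qed.

End Cis.

(** * Bounds and limits for cotangents *)

Section Cot.
Variable R : realType.
Implicit Types x t : R.

Lemma sin_lex x : 0 <= x -> sin x <= x.
Proof.
move=> x0; rewrite -subr_ge0.
pose f := fun y : R => y - sin y.
have df y : is_derive y (1:R) f (1 - cos y) by apply: is_deriveB.
have := @ger0_derive1_ndecr R f 0 x _ _ _ 0 x (lexx _) x0 (lexx _).
rewrite /f sin0 subr0; apply.
- by move=> y _; case: (df y).
- by move=> y _; rewrite derive1E (@derive_val _ _ _ _ _ _ _ (df y)) subr_ge0 cos_le1.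
- apply: derivable_within_continuous => y _; by case: (df y).
Qed.

(** The difference of the two sides has derivative [y * sin y], nonnegative up to [pi]. *)
Lemma mul_cos_le_sin x : 0 <= x <= pi -> x * cos x <= sin x.
Proof.
move=> /andP[x0 xpi]; rewrite -subr_ge0.
pose f := fun y : R => sin y - y * cos y.
have df y : is_derive y (1:R) f (y * sin y).
  apply: is_derive_eq; rewrite /GRing.scale /=; ring.
have := @ger0_derive1_ndecr R f 0 x _ _ _ 0 x (lexx _) x0 (lexx _).
rewrite /f sin0 mul0r subr0; apply.
- by move=> y _; case: (df y).
- move=> y; rewrite in_itv /= => /andP[y0 yx].
  rewrite derive1E (@derive_val _ _ _ _ _ _ _ (df y)) mulr_ge0 ?(ltW y0) //.
  by rewrite sin_ge0_pi // (ltW y0) (le_trans (ltW yx)).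
- apply: derivable_within_continuous => y _; by case: (df y).
Qed.

Definition cot x : R := cos x / sin x.

Lemma cot_ge0 x : 0 < x <= pi / 2 -> 0 <= cot x.
Proof.
move=> /andP[x0 x1]; have p0 := pi_gt0 R.
rewrite divr_ge0 ?cos_ge0_pihalf ?sin_ge0_pi //; lra.
Qed.

Lemma mul_cot_le1 x : 0 < x < pi -> x * cot x <= 1.
Proof.
move=> /[dup] xpi /andP[x0 x1].
by rewrite /cot mulrA ler_pdivrMr ?sin_gt0_pi // mul1r mul_cos_le_sin // !ltW.
Qed.

(** Follows from [sin x <= x]. Together with [mul_cot_le1] it encloses [x * cot x] between [cos x]
    and 1, hence determines its limit at 0. *)
Lemma cos_le_mul_cot x : 0 < x <= pi / 2 -> cos x <= x * cot x.
Proof.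
move=> /andP[x0 x1]; have p0 := pi_gt0 R.
have s0 : 0 < sin x by apply: sin_gt0_pi; lra.
rewrite /cot mulrA ler_pdivlMr // mulrC ler_wpM2r ?sin_lex ?(ltW x0) //.
by apply: cos_ge0_pihalf; lra.
Qed.

Lemma cotBpi x : cot (pi - x) = - cot x.
Proof. by rewrite /cot cosB sinB cospi sinpi !mul0r !mulN1r add0r addr0 opprK mulNr. Qed.

(** Clearing denominators turns equal cotangents into [sin (t - x) = 0], impossible for
    [0 < t - x < pi]. *)
Lemma cot_inj x t : 0 < x < pi -> 0 < t < pi -> cot x = cot t -> x = t.
Proof.
wlog xt : x t / x <= t => [wl hx ht e|].
  by have [?|/ltW ?] := leP x t; [exact: wl | apply/esym/wl].
move=> /[dup] hx /andP[x0 xp] /[dup] ht /andP[t0 tp] e.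
apply/eqP; rewrite eq_le xt /= leNgt; apply/negP => xlt.
have : 0 < sin (t - x) by apply: sin_gt0_pi; lra.
have sx := sin_gt0_pi hx; have st := sin_gt0_pi ht.
move/eqP: e; rewrite /cot eqr_div ?(gt_eqF sx) ?(gt_eqF st) // => /eqP e.
by rewrite sinB -e mulrC subrr ltxx.
Qed.

Definition cot_node (p k : nat) : R := cot (k%:R * (pi / p.*2.+1%:R)).

Lemma node_bound (p k : nat) : (0 < k <= p)%N ->
  0 < (k%:R * (pi / p.*2.+1%:R) : R) <= pi / 2.
Proof.
move=> /andP[k0 kp]; have p0 := pi_gt0 R.
rewrite mulr_gt0 ?divr_gt0 ?ltr0n //= mulrCA ler_pM2l //.
rewrite ler_pdivrMr ?ltr0n // mulrC ler_pdivlMr // -natrM ler_nat; lia.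
Qed.

Lemma cot_node_ge0 (p k : nat) : (0 < k <= p)%N -> 0 <= pi / p.*2.+1%:R * cot_node p k.
Proof.
move=> kp; apply: mulr_ge0; first by rewrite divr_ge0 ?pi_ge0.
by apply: cot_ge0; exact: node_bound.
Qed.

Lemma cot_node_le (p k : nat) : (0 < k <= p)%N ->
  pi / p.*2.+1%:R * cot_node p k <= k%:R^-1.
Proof.
move=> /[dup] kp /andP[k0 _]; rewrite -[leRHS]mul1r ler_pdivlMr ?ltr0n //.
rewrite mulrC mulrA mul_cot_le1 //; have := node_bound _ _ kp; have := pi_gt0 R.
by move=> p0 /andP[-> h]; apply: le_lt_trans h _; lra.
Qed.

(** With [t = k pi / (2p + 1)] the scaled node is [t * cot t / k], squeezed between [cos t / k] and
    [1 / k]. *)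
Lemma cvg_cot_node (k : nat) : (0 < k)%N ->
  (fun p : nat => pi / p.*2.+1%:R * cot_node p k) @ \oo --> (k%:R^-1 : R).
Proof.
move=> k0.
have hM : (fun p : nat => p.*2.+1%:R^-1 : R) @ \oo --> (0 : R).
  apply: (@squeeze_cvgr _ _ _ _ (fun=> 0) (@harmonic R)).
  - near=> p; rewrite invr_ge0 ler0n /= /harmonic lef_pV2 ?posrE ?ltr0n // ler_nat; lia.
  - exact: cvg_cst.
  - exact: cvg_harmonic.
have ht : (fun p : nat => k%:R * (pi / p.*2.+1%:R) : R) @ \oo --> (0 : R).
  have -> : 0 = k%:R * (pi * 0) :> R by rewrite !mulr0.
  by apply: cvgMr; apply: cvgMr.
have hc : (fun p : nat => cos (k%:R * (pi / p.*2.+1%:R) : R) / k%:R) @ \oo --> (k%:R^-1 : R).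
  rewrite -[X in _ --> X]mul1r; apply: cvgMl; rewrite -[X in _ --> X](cos0 R).
  exact: (@cvg_comp _ _ _ (fun p : nat => k%:R * (pi / p.*2.+1%:R) : R) (@cos R) _ _ _ ht
    (@continuous_cos R 0)).
apply: (squeeze_cvgr _ hc (cvg_cst _)).
near=> p; have kp : (0 < k <= p)%N by rewrite k0 /=; near: p; exact: nbhs_infty_ge.
rewrite cot_node_le // andbT ler_pdivrMr ?ltr0n // [leRHS]mulrC [leRHS]mulrA.
by apply: cos_le_mul_cot; exact: node_bound.
Unshelve. all: by end_near.
Qed.

End Cot.

(** * Asymptotics of binomial coefficients *)

Section Binomials.
Variable R : realType.

Lemma cvg_natr_inv : (fun M : nat => M%:R^-1 : R) @ \oo --> (0 : R).
Proof. by rewrite -cvg_shiftS; exact: cvg_harmonic. Qed.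

(** Each further factor [(M - l) / M] tends to 1. *)
Lemma cvg_ffact_expn (l : nat) :
  (fun M : nat => (M ^_ l)%:R / M%:R ^+ l : R) @ \oo --> (1 : R).
Proof.
elim: l => [|l IH].
  by apply: cvg_near_cst; near=> M; rewrite ffactn0 expr0 divr1.
have h : (fun M : nat => 1 - l%:R * M%:R^-1 : R) @ \oo --> (1 : R).
  rewrite -[X in _ --> X]subr0 -[X in _ --> _ - X](mulr0 l%:R).
  by apply: cvgB; [exact: cvg_cst | apply: cvgMr; exact: cvg_natr_inv].
rewrite -[X in _ --> X]mulr1; apply: cvg_trans (cvgM IH h); apply: near_eq_cvg.
near=> M.
have lM : (l < M)%N by near: M; exact: nbhs_infty_gt.
have M0 : M%:R != 0 :> R by rewrite pnatr_eq0; lia.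
rewrite /= ffactnSr natrM natrB ?(ltnW lM) // exprSr; field.
by rewrite expf_neq0 M0.
Unshelve. all: by end_near.
Qed.

(** The binomial grows like [M ^ l / l!]; for [l < N] a positive power of [M^-1] remains and sends
    the quotient to 0. *)
Lemma cvg_bin_expn (N l : nat) : (l <= N)%N ->
  (fun M : nat => ('C(M, l))%:R / M%:R ^+ N : R) @ \oo --> ((l == N)%:R / N`!%:R : R).
Proof.
move=> lN.
have -> : (fun M : nat => ('C(M, l))%:R / M%:R ^+ N : R) =
   (fun M : nat => (M ^_ l)%:R / M%:R ^+ l * (M%:R^-1 ^+ (N - l) / l`!%:R)).
  apply/funext => M; rewrite -bin_ffact natrM -{1}(subnKC lN) exprD exprVn invfM.
  set a := (M%:R ^+ l)^-1; set b := (M%:R ^+ (N - l))^-1.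
  by field; rewrite pnatr_eq0 -lt0n fact_gt0.
rewrite -[X in _ --> X]mul1r; apply: cvgM; first exact: cvg_ffact_expn.
have [->|lN'] := eqVneq l N.
  rewrite subnn; under eq_fun do rewrite expr0.
  exact: cvg_cst.
have k0 : (0 < N - l)%N by rewrite subn_gt0 ltn_neqAle lN' lN.
rewrite mul0r -[X in _ --> X](mul0r (l`!%:R^-1 : R)).
have : (fun M : nat => M%:R^-1 ^+ (N - l) : R) @ \oo --> (0 ^+ (N - l) : R).
  exact: (@cvg_comp _ _ _ (fun M : nat => M%:R^-1 : R) (fun x => x ^+
    (N - l)) _ _ _ cvg_natr_inv (@exprn_continuous _ _ 0)).
rewrite expr0n gtn_eqF // => h.
by apply: cvgMl.
Qed.
End Binomials.

(** * The finite sine product over cotangents *)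

Lemma coef_exp_XaddC (F : comNzRingType) (c : F) (n k : nat) :
  (('X + c%:P) ^+ n)`_k = c ^+ (n - k) *+ 'C(n, k).
Proof.
rewrite addrC exprDn coef_sum; have [nk|kn] := ltnP n k.
  rewrite bin_small // mulr0n big1 // => i _.
  have ik : (i < k)%N by apply: leq_ltn_trans nk; rewrite -ltnS.
  by rewrite -polyC_exp coefMn coefCM coefXn (gtn_eqF ik) mulr0 mul0rn.
rewrite (bigD1 (Ordinal (kn : k < n.+1)%N)) //= [X in _ + X]big1 => [|i ik].
  by rewrite addr0 -polyC_exp coefMn coefCM coefXn eqxx mulr1.
rewrite -polyC_exp coefMn coefCM coefXn (_ : (k == i) = false) ?mulr0 ?mul0rn //.
by apply/eqP => e; case/eqP: ik; apply: val_inj.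
Qed.

Section CotProduct.
Variable R : realType.
Local Notation C := R[i].
Local Open Scope complex_scope.

(** At [t = k pi / M] the [M]-th powers of the two numbers agree, because [cis (k pi)] is real; this
    makes the cotangents roots of the polynomial factored next. *)
Lemma cot_cis (t : R) : sin t != 0 ->
  ((cot R t)%:C + 'i%C = cis R t / (sin t)%:C) * ((cot R t)%:C - 'i%C = cis R (- t) / (sin t)%:C).
Proof.
move=> st; have sC : (sin t)%:C != 0 :> C by rewrite (inj_eq (@complexI R)).
have cE : (cot R t)%:C = (cos t)%:C / (sin t)%:C :> C by rewrite /cot fmorph_div.
split; apply: (canRL (mulfK sC)); rewrite ?mulrDl ?mulrBl cE divfK //;
  apply/eqP; rewrite eq_complex /= ?cosN ?sinN; apply/andP; split; apply/eqP; ring.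
Qed.

(** As a polynomial in [x] the left side loses its top term and has degree [M - 1] with leading
    coefficient [2 'i M]. It vanishes at [M - 1] distinct cotangents, hence splits completely. *)
Lemma sub_exp_cot_prod (M : nat) (x : C) : (0 < M)%N ->
  (x + 'i%C) ^+ M - (x - 'i%C) ^+ M =
  2 * 'i%C * M%:R * \prod_(1 <= k < M) (x - (cot R (k%:R * (pi / M%:R)))%:C).
Proof.
case: M => // M _.
pose p : {poly C} := ('X + ('i%C)%:P) ^+ M.+1 - ('X - ('i%C)%:P) ^+ M.+1.
pose rs : seq C := [seq (cot R (k%:R * (pi / M.+1%:R)))%:C | k <- iota 1 M].
have pE y : p.[y] = (y + 'i%C) ^+ M.+1 - (y - 'i%C) ^+ M.+1 by rewrite /p !hornerE.
have node k : k \in iota 1 M -> 0 < (k%:R * (pi / M.+1%:R) : R) < pi.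
  rewrite mem_iota => /andP[k0 kM]; rewrite mulr_gt0 ?divr_gt0 ?pi_gt0 ?ltr0n //=.
  by rewrite mulrCA gtr_pMr ?pi_gt0 // ltr_pdivrMr ?ltr0n // mul1r ltr_nat -add1n.
have i0 : 2 * 'i%C * M.+1%:R != 0 :> C.
  rewrite mulf_neq0 ?pnatr_eq0 // mulf_neq0 ?pnatr_eq0 // eq_complex /=.
  by rewrite oner_eq0 andbF.
have pM : p`_M = 2 * 'i%C * M.+1%:R.
  rewrite /p coefB -polyCN !coef_exp_XaddC subSnn binSn !expr1 -mulr_natr.
  ring.
have sz : (size p <= M.+1)%N.
  apply/leq_sizeP => k Mk; rewrite /p coefB -polyCN !coef_exp_XaddC.
  (* [Mk] unfolds to [M.+1 - k == 0] in truncated subtraction, so both constants are raised to the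
     power 0 and the coefficients cancel. *)
  by rewrite (eqP Mk) !expr0 subrr.
have sp : size p = (size rs).+1.
  rewrite size_map size_iota; apply/eqP; rewrite eqn_leq sz /=.
  by rewrite ltnNge; apply/negP => /leq_sizeP/(_ M (leqnn _)) /eqP; rewrite pM (negbTE i0).
have lp : lead_coef p = 2 * 'i%C * M.+1%:R by rewrite /lead_coef sp size_map size_iota.
rewrite -pE (@prod_root_poly _ p rs) ?lp ?big_map ?/index_iota ?subn1 //.
- apply/allP => _ /mapP[k /node kn ->]; rewrite /root pE; have s0 := sin_gt0_pi kn.
  have [-> ->] := cot_cis (k%:R * (pi / M.+1%:R)) (lt0r_neq0 s0).
  rewrite !expr_div_n !cis_expn subr_eq0; apply/eqP; congr (_ / _).
  rewrite mulrN mulrCA [M.+1%:R * _]mulrC divfK ?pnatr_eq0 //.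
  rewrite /cis cosN sinN.
  suff -> : sin (k%:R * pi) = 0 :> R by rewrite oppr0.
  by elim: k {kn s0} => [|k IH]; rewrite ?mul0r ?sin0 // mulrSr mulrDl mul1r sinDpi IH oppr0.
- rewrite map_inj_in_uniq ?iota_uniq // => j k /node jn /node kn /complexI.
  move=> /(cot_inj _ _ _ jn kn) /mulIf e; apply/eqP; rewrite -(eqr_nat R); apply/eqP/e.
  by rewrite gt_eqF // divr_gt0 ?pi_gt0 ?ltr0n.
Qed.

(** Use the previous product at [x^-1] and pair the index [k] with [2p + 1 - k]: their cotangents
    are opposite, so the two factors give a difference of squares. *)
Lemma sub_exp_cot_node (p : nat) (x : C) :
  (1 + 'i%C * x) ^+ p.*2.+1 - (1 - 'i%C * x) ^+ p.*2.+1 =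
  2 * 'i%C * p.*2.+1%:R * x * \prod_(k < p) (1 - ((cot_node R p k.+1)%:C * x) ^+ 2).
Proof.
have [->|x0] := eqVneq x 0; first by rewrite !mulr0 subr0 addr0 subrr mul0r.
have -> : 1 + 'i%C * x = x * (x^-1 + 'i%C) by field.
have -> : 1 - 'i%C * x = x * (x^-1 - 'i%C) by field.
rewrite !exprMn -mulrBr sub_exp_cot_prod //.
pose F k := 1 - (cot_node R p k)%:C * x.
transitivity (2 * 'i%C * p.*2.+1%:R * x * \prod_(1 <= k < p.*2.+1) F k).
  rewrite /F prod_scaleV // size_iota subn1 /= /cot_node exprS; ring.
congr (_ * _); rewrite (@big_cat_nat _ _ _ p.+1) //= ?ltnS -?addnn ?leq_addl //.
rewrite -{2}[p.+1]add1n -addSn big_addn addnK [X in _ * X]big_nat_rev /= -big_split /=.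
rewrite big_add1 /= big_mkord; apply: eq_bigr => k _; rewrite /F.
have kp := ltn_ord k.
have -> : cot_node R p (1 + p.+1 - k.+2 + p) = - cot_node R p k.+1.
  rewrite /cot_node -cotBpi; congr cot.
  have -> : (1 + p.+1 - k.+2 + p = p.*2.+1 - k.+1)%N by rewrite -addnn; lia.
  rewrite natrB; last by rewrite -addnn; lia.
  by field.
rewrite rmorphN; ring.
Qed.

(** The exponents add up to [m (m - 1) / 2], and [w ^ (m / 2) = 'i]. *)
Lemma prod_root_w (m : nat) : (0 < m)%N -> ~~ odd m ->
  \prod_(j < m) root_w R m ^+ j = 'i%C ^+ m.-1.
Proof.
move=> m0 me; rewrite -(root_w_half R _ m0 me) -exprM prodrXr -(big_mkord xpredT id).
congr (_ ^+ _); rewrite bin2_sum bin2.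
by rewrite -{1}(odd_double_half m) (negbTE me) -doubleMl doubleK.
Qed.

(** For a fixed node the squares [w ^ (2 j)] run through all [m]-th roots of unity, so
    [prod_1Bunity] collapses the product over [j] to one factor in [x ^ (2 m)]. *)
Lemma prod_sub_exp (m p : nat) (x : C) : (0 < m)%N -> ~~ odd m ->
  \prod_(j < m) ((1 + 'i%C * (root_w R m ^+ j * x)) ^+ p.*2.+1
                 - (1 - 'i%C * (root_w R m ^+ j * x)) ^+ p.*2.+1) =
  (2 * 'i%C * p.*2.+1%:R) ^+ m * 'i%C ^+ m.-1 * x ^+ m *
  \prod_(k < p) (1 - (cot_node R p k.+1)%:C ^+ (2 * m) * x ^+ (2 * m)).
Proof.
move=> m0 me; pose K : C := 2 * 'i%C * p.*2.+1%:R.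
rewrite -/K (eq_bigr (fun j : 'I_m => K * root_w R m ^+ j * x *
  \prod_(k < p) (1 - ((cot_node R p k.+1)%:C * (root_w R m ^+ j * x)) ^+ 2))); last first.
  by move=> j _; rewrite sub_exp_cot_node mulrA.
rewrite !big_split /= !prodr_const !card_ord (prod_root_w _ m0 me) -!exprMn; congr (_ * _).
rewrite exchange_big /=.
apply: eq_bigr => k _.
have := prod_1Bunity _ _ _ (((cot_node R p k.+1)%:C * x) ^+ 2) (root_w_prim R _ m0).
rewrite -(exprM (_ * x)) [(_ * x) ^+ (2 * m)]exprMn => <-.
by apply: eq_bigr => j _; rewrite mulrCA exprMn [in LHS]exprAC.
Qed.
End CotProduct.

(** * Generating polynomials of the signed sums *)

Lemma coef_prod_1D_scaleX (F : comNzRingType) (I : Type) (r : seq I) (a : I -> F) :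
  ((\prod_(j <- r) (1 + a j *: 'X))`_0 = 1) *
  ((\prod_(j <- r) (1 + a j *: 'X))`_1 = \sum_(j <- r) a j).
Proof.
elim: r => [|j r [IH0 IH1]]; first by rewrite !big_nil !coefC.
rewrite !big_cons mulrDl mul1r -scalerAl ![('X * _)]mulrC !coefD !coefZ !coefMX /=.
by rewrite IH0 IH1 mulr0 mulr1 addr0 addrC.
Qed.

(** Taking [- y k *: 'X^d] for [k] in [A] and 1 elsewhere contributes in degree [d * #|A|] only;
    what remains is an elementary symmetric function. *)
Lemma coef_prod_1B_scaleXn (F : comNzRingType) (p d n : nat) (y : 'I_p -> F) : (0 < d)%N ->
  (\prod_(k < p) (1 - y k *: 'X^d))`_(d * n) =
  (-1) ^+ n * \sum_(A : {set 'I_p} | #|A| == n) \prod_(k in A) y k.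
Proof.
move=> d0; under eq_bigr do rewrite addrC -scaleNr.
rewrite bigA_distr coef_sum mulr_sumr [RHS]big_mkcond /=.
apply: eq_bigr => A _; rewrite -big_mkcond /=.
have -> : \prod_(k in A) (- y k *: 'X^d) =
    ((-1) ^+ #|A| * \prod_(k in A) y k) *: 'X^(d * #|A|) :> {poly F}.
  rewrite -prodr_const -big_split /= exprM -prodr_const.
  by rewrite scaler_prod; congr (_ *: _); apply: eq_bigr => k _; rewrite mulN1r.
rewrite coefZ coefXn eqn_pmul2l // eq_sym.
by case: eqP => [->|_]; rewrite ?mulr1 ?mulr0.
Qed.

Definition parity {d : nat} (b : {ffun 'I_d -> bool}) : bool := \big[addb/false]_j b j.

Lemma signr_parity (F : nzRingType) d (b : {ffun 'I_d -> bool}) :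
  (-1) ^+ parity b = \prod_j (-1) ^+ b j :> F.
Proof. by apply: (big_morph (fun c : bool => (-1) ^+ c : F)) => // c e; rewrite signr_addb. Qed.

(** Distributing the product selects one of two terms for every [j]; the minus signs collected
    amount to the parity. *)
Lemma prod_diff_signs (F : comNzRingType) d (h : 'I_d -> F -> F) :
  \prod_j (h j 1 - h j (-1)) =
  \sum_(b : {ffun 'I_d -> bool}) (-1) ^+ parity b * \prod_j h j ((-1) ^+ b j).
Proof.
under [RHS]eq_bigr do rewrite signr_parity -big_split /=.
rewrite -(bigA_distr_bigA (fun j (c : bool) => (-1) ^+ c * h j ((-1) ^+ c))).
by apply: eq_bigr => j _; rewrite big_bool /= expr0 expr1 mul1r mulN1r addrC.
Qed.

Section SignPolynomials.
Variable R : realType.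
Local Notation C := R[i].
Local Open Scope complex_scope.
Variable m : nat.
Hypotheses (m_gt0 : (0 < m)%N) (m_even : ~~ odd m).
Local Notation w := (root_w R m).

(** Unlike in [signed_sum], the coefficient of [w ^ (m - 1)] carries a free sign too, which makes
    rotation and negation act on the sign vectors. *)
Definition full_sum (b : {ffun 'I_m -> bool}) : C :=
  \sum_j (-1) ^+ b j * w ^+ (m - j.+1).

Definition sign_poly (b : {ffun 'I_m -> bool}) : {poly C} :=
  \prod_j (1 + ('i%C * ((-1) ^+ b j * w ^+ (m - j.+1))) *: 'X).

Lemma sum_sign_poly (p : nat) :
  \sum_b (-1) ^+ parity b *: sign_poly b ^+ p.*2.+1 =
  ((2 * 'i%C * p.*2.+1%:R) ^+ m * 'i%C ^+ m.-1) *: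
    ('X^m * \prod_(k < p) (1 - (cot_node R p k.+1)%:C ^+ (2 * m) *: 'X^(2 * m))).
Proof.
apply: horner_poly_inj => x.
rewrite hornerZ hornerM hornerXn horner_prod horner_sum.
under [in RHS]eq_bigr do rewrite !hornerE.
(* Reversing the index replaces [w ^ j] by the descending powers used in [sign_poly]. *)
rewrite mulrA -prod_sub_exp // (reindex_inj rev_ord_inj) /=.
have := prod_diff_signs _ _ (fun (j : 'I_m) (c : C) => (1 + 'i%C * (c * w ^+
  (m - j.+1) * x)) ^+ p.*2.+1).
under eq_bigr do rewrite mul1r mulN1r mulNr mulrN.
move=> ->; apply: eq_bigr => b _; rewrite hornerZ horner_exp /sign_poly horner_prod.
by congr (_ * _); rewrite -prodrXl; apply: eq_bigr => j _; rewrite !hornerE.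
Qed.

(** Compares one coefficient in [sum_sign_poly], the factor ['X^m] shifting the degree to
    [2 * m * n]. On the left [p] now enters only through the binomials. *)
Lemma sign_poly_elementary (p n : nat) :
  \sum_(l < (2 * m * n + m).+1) ('C(p.*2.+1, l))%:R *
    \sum_b (-1) ^+ parity b * ((sign_poly b - 1) ^+ l)`_(2 * m * n + m) =
  (2 * 'i%C * p.*2.+1%:R) ^+ m * 'i%C ^+ m.-1 * (-1) ^+ n *
    \sum_(A : {set 'I_p} | #|A| == n)
      \prod_(k in A) (cot_node R p k.+1)%:C ^+ (2 * m).
Proof.
have := congr1 (fun q : {poly C} => q`_(2 * m * n + m)) (sum_sign_poly p).
rewrite coefZ coefXnM ltnNge leq_addl /= addnK coef_prod_1B_scaleXn ?muln_gt0 //.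
move=> h; apply: etrans (etrans h _); last by rewrite mulrA.
rewrite coef_sum.
under eq_bigr do rewrite mulr_sumr.
rewrite exchange_big; apply: eq_bigr => b _.
rewrite coefZ coef_exp_binomial ?coef_prod_1D_scaleX // mulr_sumr.
by apply: eq_bigr => l _; rewrite mulrCA.
Qed.

(** Only the linear term of [sign_poly b - 1] matters here; this is where powers of signed sums
    appear. *)
Lemma coef_sign_poly_diag (b : {ffun 'I_m -> bool}) (N : nat) :
  ((sign_poly b - 1) ^+ N)`_N = ('i%C * full_sum b) ^+ N.
Proof.
have g0 : (sign_poly b - 1)`_0 = 0.
  by rewrite coefB coefC /= /sign_poly coef_prod_1D_scaleX subrr.
rewrite coef_exp_diag // coefB coefC /= subr0 /sign_poly coef_prod_1D_scaleX.
by rewrite /full_sum mulr_sumr.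
Qed.

End SignPolynomials.

(** * Symmetries of the signed sums *)

Section SignSymmetry.
Variable R : realType.
Local Notation C := R[i].

Lemma parity_card d (e : {ffun 'I_d -> bool}) : parity e = odd #|[set j | e j]%SET|.
Proof.
rewrite /parity -sum1_card [in RHS](eq_bigl (fun j => e j)) => [|j]; last by rewrite finset.in_set.
rewrite [in RHS]big_mkcond /= (big_morph odd oddD (erefl : odd 0 = false)).
by apply: eq_bigr => j _; case: (e j).
Qed.

Lemma sign_prodE d (e : signs d) : (sign_prod e == 1) = ~~ parity e.
Proof. by rewrite /sign_prod parity_card; case: odd. Qed.

(** Models multiplication of a signed sum by [w]: exponents move up by one, and the sign that would
    reach [w ^ m = -1] wraps round to the constant term, negated. *)
Definition rotate_signs {m : nat} (b : {ffun 'I_m -> bool}) : {ffun 'I_m -> bool} :=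
  [ffun j => b (ordS j) (+) (ordS j == 0%N :> nat)].

Lemma rotate_signs_inj m : injective (@rotate_signs m).
Proof.
move=> b c /ffunP bc; apply/ffunP => j; have := bc (ord_pred j).
by rewrite !ffunE ord_predK => /addIb.
Qed.

(** A cyclic shift keeps the parity, and exactly one entry is flipped. *)
Lemma parity_rotate m (b : {ffun 'I_m.+1 -> bool}) : parity (rotate_signs b) = ~~ parity b.
Proof.
rewrite /parity; under eq_bigr do rewrite ffunE.
transitivity (\big[addb/false]_(j < m.+1) (b j (+) (j == 0%N :> nat))).
  by rewrite [RHS](reindex_inj (@ordS_inj m.+1)).
have e0 : \big[addb/false]_(j < m.+1) (j == 0%N :> nat) = true by rewrite big_ord_recl big1.
by rewrite big_split /= e0 addbT.
Qed.

Lemma full_sum_rotate m (b : {ffun 'I_m.+1 -> bool}) :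
  full_sum R m.+1 (rotate_signs b) = root_w R m.+1 * full_sum R m.+1 b.
Proof.
have wm := root_w_expm R m.+1 (ltn0Sn m).
set w := root_w R m.+1 in wm *; rewrite /full_sum -/w mulr_sumr.
rewrite [RHS](reindex_inj (@ordS_inj m.+1)) /=; apply: eq_bigr => j _.
rewrite ffunE signr_addb mulrCA -mulrA; congr (_ * _).
rewrite /= -exprS; have [jm|jm] := eqVneq (j : nat) m.
  by rewrite jm modnn /= subnn subSS subn0 expr0 wm expr1 mulr1.
have jlt : (j < m)%N by rewrite ltn_neqAle jm -ltnS ltn_ord.
by rewrite modn_small //= expr0 mul1r !subSS subnSK.
Qed.

(** The new first entry is +1, the fixed coefficient of the leading power in [signed_sum]. *)
Definition extend_signs {d : nat} (e : signs d) : {ffun 'I_d.+1 -> bool} :=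
  [ffun j => if unlift ord0 j is Some j' then e j' else false].

Lemma parity_extend d (e : signs d) : parity (extend_signs e) = parity e.
Proof.
rewrite /parity big_ord_recl ffunE unlift_none /=.
by apply: eq_bigr => j _; rewrite ffunE liftK.
Qed.

Lemma full_sum_extend d (e : signs d) :
  full_sum R d.+1 (extend_signs e) = @signed_sum R d.+1 e.
Proof.
rewrite /full_sum /signed_sum big_ord_recl ffunE unlift_none /= mul1r; congr (_ + _).
apply: eq_bigr => j _; rewrite ffunE liftK /entry.
have -> : (d.+1 - (lift ord0 j).+1 = d.+1 - 2 - j)%N by rewrite -subnDA.
by case: (e j).
Qed.

Lemma sum_extend_signs (d : nat) (F : {ffun 'I_d.+1 -> bool} -> C) :
  \sum_(b | ~~ parity b && ~~ b ord0) F b =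
  \sum_(e : signs d | ~~ parity e) F (extend_signs e).
Proof.
rewrite (reindex_onto (@extend_signs d) (fun b => [ffun j => b (lift ord0 j)])) /=.
  apply: eq_bigl => e; rewrite parity_extend ffunE unlift_none andbT.
  suff -> : [ffun j => extend_signs e (lift ord0 j)] = e by rewrite eqxx andbT.
  by apply/ffunP => j; rewrite !ffunE liftK.
move=> b /andP[_ b0]; apply/ffunP => j; rewrite ffunE.
by case: unliftP => [j' ->|->]; rewrite ?ffunE // (negbTE b0).
Qed.

Definition flip_signs {m : nat} (b : {ffun 'I_m -> bool}) : {ffun 'I_m -> bool} :=
  [ffun j => ~~ b j].

Lemma parity_flip m (b : {ffun 'I_m -> bool}) : parity (flip_signs b) = odd m (+) parity b.
Proof.
rewrite /parity; under eq_bigr do rewrite ffunE -addTb.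
rewrite big_split /=; congr (_ (+) _).
by elim: (m) => [|k IH]; rewrite ?big_ord0 // big_ord_recl IH.
Qed.

Lemma full_sum_flip m (b : {ffun 'I_m -> bool}) :
  full_sum R m (flip_signs b) = - full_sum R m b.
Proof.
rewrite /full_sum -sumrN; apply: eq_bigr => j _.
by rewrite ffunE signrN mulNr.
Qed.

(** The factor 4 arises from two symmetries. Rotation exchanges odd and even vectors, and its factor
    [w ^ N = -1] cancels the parity sign. Global negation keeps the parity as [m] is even and the
    power as the exponent is even, so the first entry may be fixed to +1. *)
Lemma sum_full_signs (m n : nat) : (0 < m)%N -> ~~ odd m ->
  \sum_b (-1) ^+ parity b * full_sum R m b ^+ (2 * m * n + m) =
  4 * \sum_(e : signs m.-1 | sign_prod e == 1) @signed_sum R m e ^+ (2 * m * n + m).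
Proof.
case: m => // m _ me; set N := (2 * m.+1 * n + m.+1)%N.
have wN : root_w R m.+1 ^+ N = -1.
  by rewrite exprD -mulnA mulnCA exprM root_w_expm // exprM sqrrN expr1n expr1n mul1r.
have Ne : ~~ odd N by rewrite /N oddD -mulnA mul2n odd_double.
pose T := \sum_(b : {ffun 'I_m.+1 -> bool} | ~~ parity b) full_sum R m.+1 b ^+ N.
have Ttrue : \sum_(b : {ffun 'I_m.+1 -> bool} | parity b) full_sum R m.+1 b ^+ N = - T.
  rewrite (reindex_inj (@rotate_signs_inj m.+1)) /= -sumrN.
  apply: eq_big => [b|b _]; first by rewrite parity_rotate.
  by rewrite full_sum_rotate exprMn wN mulN1r.
have TE : T = 2 * \sum_(e : signs m | ~~ parity e) @signed_sum R m.+1 e ^+ N.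
  have ext : \sum_(b : {ffun 'I_m.+1 -> bool} | ~~ parity b && ~~ b ord0) full_sum R m.+1 b ^+ N =
      \sum_(e : signs m | ~~ parity e) @signed_sum R m.+1 e ^+ N.
    by rewrite sum_extend_signs; apply: eq_bigr => e _; rewrite full_sum_extend.
  have flip_inj : injective (@flip_signs m.+1).
    by move=> b c /ffunP bc; apply/ffunP => j; have := bc j; rewrite !ffunE => /negb_inj.
  rewrite /T (bigID (fun b : {ffun _ -> _} => ~~ b ord0)) /= ext.
  rewrite mulr_natl mulr2n; congr (_ + _); rewrite -ext (reindex_inj flip_inj) /=.
  apply: eq_big => [b|b _]; first by rewrite parity_flip (negbTE me) ffunE negbK.
  by rewrite full_sum_flip exprNn -signr_odd (negbTE Ne) mul1r.
rewrite (bigID (fun b : {ffun _ -> _} => parity b)) /=.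
rewrite (eq_bigr (fun b => - full_sum R m.+1 b ^+ N)) => [|b ->]; last by rewrite mulN1r.
rewrite [X in _ + X](eq_bigr (fun b => full_sum R m.+1 b ^+ N)) => [|b /negbTE->];
  last by rewrite mul1r.
rewrite sumrN Ttrue opprK -/T TE [in RHS](eq_bigl
  (fun e : signs m => ~~ parity e)) => [|e]; last exact: sign_prodE.
by ring.
Qed.

End SignSymmetry.

(** * Passage to the limit *)

Section Squeeze.
Variable R : realType.

Lemma cvg_sum_seq (T : choiceType) (s : seq T) (u : T -> nat -> R) (v : T -> R) :
  (forall k, k \in s -> u k @ \oo --> v k) ->
  (fun p => \sum_(k <- s) u k p) @ \oo --> \sum_(k <- s) v k.
Proof.
elim: s => [|k s IH] h.
  by rewrite big_nil; under eq_fun do rewrite big_nil; exact: cvg_cst.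
rewrite big_cons; under eq_fun do rewrite big_cons.
apply: cvgD; first by apply: h; rewrite mem_head.
by apply: IH => j js; apply: h; rewrite in_cons js orbT.
Qed.

Lemma near_all_seq (T : choiceType) (s : seq T) (P : nat -> T -> Prop) :
  (forall k, k \in s -> \forall p \near \oo, P p k) ->
  \forall p \near \oo, forall k, k \in s -> P p k.
Proof.
elim: s => [|k s IH] h; first by near=> p.
have hk := h k (mem_head _ _).
have hs : \forall p \near \oo, forall j, j \in s -> P p j.
  by apply: IH => j js; apply: h; rewrite in_cons js orbT.
near=> p => j; rewrite in_cons => /orP[/eqP ->|]; first by near: p.
by move: j; near: p.
Unshelve. all: by end_near.
Qed.

(* Each stage is bounded by the full sum, and each finite partial sum is the
   limit of partial sums of the stages: no uniformity is needed. *)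
Lemma esum_eq_lim (T : choiceType) (S : set T) (Q : nat -> set T) (g : nat -> T -> R)
    (f : T -> R) (l : R) :
  (forall p, finite_set (Q p)) -> (forall p, Q p `<=` S) ->
  (forall p k, Q p k -> 0 <= g p k <= f k) ->
  (forall k, S k -> \forall p \near \oo, Q p k) ->
  (forall k, S k -> (fun p => g p k) @ \oo --> f k) ->
  (fun p => \sum_(k \in Q p) g p k) @ \oo --> l -> \esum_(k in S) (f k)%:E = l%:E.
Proof.
move=> Qfin QS gf QF gcvg el; apply/eqP; rewrite eq_le; apply/andP; split.
  apply: ub_ereal_sup => _ [F [Ffin FS] <-].
  rewrite fsumEFin // lee_fin fsbig_finite //=.
  have FP k : k \in finmap.enum_fset (fset_set F) -> F k by rewrite in_fset_set // inE.
  have hl := cvg_sum_seq _ _ _ _ (fun k h => gcvg k (FS k (FP k h))).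
  apply: (ler_cvg_to hl el).
  have hQ := near_all_seq _ _ _ (fun k h => QF k (FS k (FP k h))).
  near=> p.
  have FQ : F `<=` Q p.
    move=> k Fk; have : forall k, k \in finmap.enum_fset (fset_set F) -> Q p k by near: p.
    by apply; rewrite in_fset_set // inE.
  rewrite -[leLHS]fsbig_finite //= -lee_fin -!fsumEFin //.
  apply: lee_fsum_nneg_subset => //.
    by move=> k; rewrite !inE; exact: FQ.
  by move=> k; rewrite !inE => /andP[_ /set_mem /gf /andP[]].
have lim_le p : ((\sum_(k \in Q p) g p k)%:E <= \esum_(k in S) (f k)%:E)%E.
  apply: esum_ge; exists (Q p); first by split.
  by rewrite -fsumEFin //; apply: lee_fsum => // k /gf /andP[_]; rewrite lee_fin.
(* An infinite sum bounds [l] trivially, so only a finite one needs an argument. *)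
have [s|s|s] := ltgtP (\esum_(k in S) (f k)%:E) +oo%E;
  [|by rewrite ltNge leey in s|by rewrite s leey].
have sE : \esum_(k in S) (f k)%:E = (fine (\esum_(k in S) (f k)%:E))%:E.
  rewrite fineK // ge0_fin_numE // esum_ge0 // => k Sk; rewrite lee_fin.
  (* [f k] is nonnegative because it dominates [g p k] at any stage [p] that contains [k]. *)
  have Qk := QF k Sk; near \oo => p.
  have /gf/andP[g0 gk] : Q p k by near: p.
  exact: le_trans gk.
rewrite sE lee_fin; apply: (cvgr_to_le el); near=> p.
by rewrite -lee_fin -sE.
Unshelve. all: by end_near.
Qed.

(** Entries are shifted by one because ['I_p] starts at 0; a set of the wrong cardinality is sent to
    the zero tuple by default. *)
Definition chain_of {p : nat} (n : nat) (A : {set 'I_p}) : n.-tuple nat :=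
  insubd (nseq_tuple n 0%N) [seq (val i).+1 | i <- enum A].

Lemma chain_ofE p n (A : {set 'I_p}) : #|A| = n ->
  chain_of n A = [seq (val i).+1 | i <- enum A] :> seq nat.
Proof. by move=> An; rewrite /chain_of val_insubd size_map -cardE An eqxx. Qed.

Definition chains (n p : nat) : set (n.-tuple nat) :=
  [set k : n.-tuple nat | path ltn 0%N k && all (geq p) k].

(** The enumeration of a set of ordinals is a subsequence of [iota 0 p], hence increasing. *)
Lemma path_succ_enum p (A : {set 'I_p}) : path ltn 0%N [seq (val i).+1 | i <- enum A].
Proof.
have : sorted ltn [seq val i | i <- enum A].
  have : subseq [seq val i | i <- enum A] (iota 0 p).
    by rewrite -val_enum_ord map_subseq // enumT; exact: filter_subseq.
  by move=> /(subseq_sorted ltn_trans); apply; exact: iota_ltn_sorted.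
rewrite (map_comp S val) path_sortedE; last exact: ltn_trans.
move=> sA; apply/andP; split; first by apply/allP => _ /mapP[j _ ->].
by rewrite sorted_map.
Qed.

Lemma chain_of_bij p n : set_bij [set A : {set 'I_p} | #|A| == n] (chains n p) (chain_of n).
Proof.
split.
- move=> A /= /eqP An; rewrite /chains /= chain_ofE // path_succ_enum /=.
  by apply/allP => _ /mapP[i _ ->] /=; rewrite ltn_ord.
- move=> A B /set_mem /= /eqP An /set_mem /= /eqP Bn /(congr1 val) /=.
  rewrite !chain_ofE // => AB; apply/setP => i.
  have mem (D : {set 'I_p}) : (i \in D) = ((val i).+1 \in [seq (val i).+1 | i <- enum D]).
    by rewrite (mem_map (f := fun i => (val i).+1)) ?mem_enum // => j k [] /val_inj.
  by rewrite !mem AB.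
- move=> k /= /andP[kp /allP kle].
  pose A := [set i : 'I_p | (val i).+1 \in val k]%SET.
  have kA : [seq (val i).+1 | i <- enum A] = k :> seq nat.
    (* Strictly increasing lists with the same members coincide. *)
    apply: (irr_sorted_eq ltn_trans ltnn).
    + exact: path_sorted (path_succ_enum _ A).
    + exact: path_sorted kp.
    + move=> j; apply/mapP/idP => [[x]|jk]; first by rewrite mem_enum finset.in_set => + ->.
      have jp := kle j jk; have j0 : (0 < j)%N.
        by move: kp; rewrite path_sortedE; [move=> /andP[/allP/(_ j jk)]|exact: ltn_trans].
      have jp' : (j.-1 < p)%N by rewrite prednK.
      by exists (Ordinal jp'); rewrite ?mem_enum ?finset.in_set /= prednK.
  have An : #|A| = n by rewrite cardE -(size_map (fun i => (val i).+1)) kA size_tuple.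
  by exists A; rewrite /= ?An ?eqxx //; apply: val_inj; rewrite /= chain_ofE.
Qed.

Lemma finite_chains n p : finite_set (chains n p).
Proof.
have [_ _ surj] := chain_of_bij p n; apply: sub_finite_set surj _.
by apply: finite_image; exact: finite_finset.
Qed.

Lemma sum_chains n p (y : nat -> R) :
  \sum_(k \in chains n p) \prod_(j <- k) y j =
  \sum_(A : {set 'I_p} | #|A| == n) \prod_(i in A) y i.+1.
Proof.
rewrite (reindex_fsbig _ _ _ _ (chain_of_bij p n)).
transitivity (\sum_(A \in [set A : {set 'I_p} | #|A| == n]) \prod_(i in A) y i.+1).
  by apply: eq_fsbigr => A /set_mem /= /eqP An; rewrite chain_ofE // big_map big_enum.
by rewrite [RHS]bigfs ?index_enum_uniq // => A _; rewrite mem_index_enum.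
Qed.
End Squeeze.

(** * Evaluation of the limit *)

Section Limit.
Variable R : realType.
Local Notation C := R[i].
Local Open Scope complex_scope.

Lemma Re_realM (r : R) (z : C) : complex.Re (r%:C * z) = r * complex.Re z.
Proof. by case: z => a b /=; rewrite mul0r subr0. Qed.

Lemma Re_sum (I : Type) (r : seq I) (F : I -> C) :
  complex.Re (\sum_(i <- r) F i) = \sum_(i <- r) complex.Re (F i).
Proof. by apply: (big_morph (@complex.Re R)) => // -[a b] [c d]. Qed.

Lemma cvg_prod_seq (T : choiceType) (s : seq T) (u : T -> nat -> R) (v : T -> R) :
  (forall k, k \in s -> u k @ \oo --> v k) ->
  (fun p => \prod_(k <- s) u k p) @ \oo --> \prod_(k <- s) v k.
Proof.
elim: s => [|k s IH] h.
  by rewrite big_nil; under eq_fun do rewrite big_nil; exact: cvg_cst.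
rewrite big_cons; under eq_fun do rewrite big_cons.
apply: cvgM; first by apply: h; rewrite mem_head.
by apply: IH => j js; apply: h; rewrite in_cons js orbT.
Qed.

Definition scaled_node (a p j : nat) : R := (pi / p.*2.+1%:R * cot_node R p j) ^+ a.

(** Stage [p] sums over the chains bounded by [p]; there each scaled node is at most its limit, so
    [esum_eq_lim] applies. *)
Lemma zeta_rep_eq_lim (a n : nat) (l : R) :
  (fun p => \sum_(A : {set 'I_p} | #|A| == n) \prod_(i in A) scaled_node a p i.+1) @ \oo --> l ->
  zeta_rep R a n = l%:E.
Proof.
move=> hl; have pos (k : n.-tuple nat) j : path ltn 0%N k -> j \in (k : seq nat) -> (0 < j)%N.
  by rewrite path_sortedE; [move=> /andP[/allP h _] /h|exact: ltn_trans].
have fE (k : n.-tuple nat) : (\prod_(j <- k) (j%:R : R)) ^- a = \prod_(j <- k) j%:R^-1 ^+ a.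
  by rewrite prodrXl prodfV exprVn.
apply: (@esum_eq_lim R _ _ (chains n) (fun p
  (k : n.-tuple nat) => \prod_(j <- k) scaled_node a p j)).
- exact: finite_chains.
- by move=> p k /= /andP[].
- move=> p k /= /andP[kp /allP kle].
  have node j : j \in (k : seq nat) -> (0 < j <= p)%N.
    by move=> jk; rewrite (pos k) //=; exact: kle.
  apply/andP; split.
    by rewrite big_seq prodr_ge0 // => j /node jp; rewrite exprn_ge0 // cot_node_ge0.
  rewrite fE big_seq [leRHS]big_seq; apply: ler_prod => j /node jp.
  by rewrite exprn_ge0 ?cot_node_ge0 //= lerXn2r ?nnegrE ?cot_node_ge0 ?invr_ge0 ?cot_node_le.
- move=> k kp; have := @near_all_seq _ (k : seq nat) (fun p j => (j <= p)%N).
  move=> /(_ (fun j _ => nbhs_infty_ge j)) h; near=> p.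
  by rewrite /chains /= kp /=; apply/allP; near: p.
- move=> k kp; rewrite fE; apply: cvg_prod_seq => j jk.
  apply: (@cvg_comp _ _ _ (fun p : nat => pi / p.*2.+1%:R * cot_node R p j) (fun x => x ^+ a)).
    by apply: cvg_cot_node; exact: pos jk.
  exact: exprn_continuous.
- by under eq_fun do rewrite sum_chains.
Unshelve. all: by end_near.
Qed.

Variables m n : nat.
Hypotheses (m_gt0 : (0 < m)%N) (m_even : ~~ odd m).
Local Notation N := (2 * m * n + m)%N.

(** [D l] multiplies the [l]-th binomial in [sign_poly_elementary], and [K] is the constant there
    without its power of [2p + 1]. Real parts are taken in [r] because the limits live in [R]. *)
Let D (l : nat) : C := \sum_b (-1) ^+ parity b * ((sign_poly R m b - 1) ^+ l)`_N.
Let K : C := (2 * 'i%C) ^+ m * 'i%C ^+ m.-1 * (-1) ^+ n.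
Let r (l : nat) : R := complex.Re (pi%:C ^+ (2 * m * n) * D l / K).

Let K_neq0 : K != 0.
Proof.
have i0 : 'i%C != 0 :> C by rewrite eq_complex /= oner_eq0 andbF.
by rewrite !mulf_neq0 ?expf_neq0 ?mulf_neq0 ?pnatr_eq0 ?oppr_eq0 ?oner_eq0.
Qed.

Lemma scaled_elementary (p : nat) :
  \sum_(A : {set 'I_p} | #|A| == n) \prod_(i in A) scaled_node (2 * m) p i.+1 =
  \sum_(l < N.+1) ('C(p.*2.+1, l))%:R / p.*2.+1%:R ^+ N * r l.
Proof.
set M : R := p.*2.+1%:R; have M0 : M != 0 by rewrite pnatr_eq0.
apply: (@complexI R); under [in RHS]eq_bigr do rewrite -Re_realM.
rewrite -Re_sum.
(* As [e] is real, it is the real part of [e%:C], so the identity may be proved over the complex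
   numbers. *)
set e := \sum_(A | _) _; suff <- : e%:C = \sum_(l < N.+1)
  (('C(p.*2.+1, l))%:R / M ^+ N)%:C * (pi%:C ^+ (2 * m * n) * D l / K) by [].
have MC0 : M%:C != 0 :> C by rewrite (inj_eq (@complexI R)).
have eE : e%:C = (pi%:C / M%:C) ^+ (2 * m * n) * \sum_(A : {set 'I_p} | #|A| == n)
      \prod_(k in A) (cot_node R p k.+1)%:C ^+ (2 * m).
  rewrite /e rmorph_sum mulr_sumr; apply: eq_bigr => A /eqP An.
  rewrite rmorph_prod exprM -An -prodr_const -big_split /=.
  by apply: eq_bigr => k _; rewrite /scaled_node rmorphXn rmorphM fmorph_div exprMn.
have := sign_poly_elementary R m m_gt0 m_even p n.
set E := \sum_(A : {set 'I_p} | _) _ in eE *; rewrite -/D => h.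
(* The [M ^ m] here and the [M ^ (2 m n)] from the scaling of the nodes together form [M ^ N]. *)
have hE : E = (\sum_(l < N.+1) ('C(p.*2.+1, l))%:R * D l) / (K * M%:C ^+ m).
  rewrite h; apply: (canRL (mulfK _)); first by rewrite mulf_neq0 ?expf_neq0.
  rewrite /K /M rmorph_nat [(2 * 'i%C * _) ^+ m]exprMn; ring.
rewrite eE hE mulr_suml mulr_sumr; apply: eq_bigr => l _.
have ME : M%:C = p.*2.+1%:R :> C by rewrite rmorph_nat.
rewrite ME in MC0; rewrite rmorphM fmorphV rmorphXn /= ME !rmorph_nat exprD expr_div_n.
move: (p.*2.+1%:R : C) MC0 => y y0; field.
by rewrite K_neq0 !expf_neq0.
Qed.

Lemma cvg_scaled_elementary :
  (fun p => \sum_(A : {set 'I_p} | #|A| == n) \prod_(i in A) scaled_node (2 * m) p i.+1)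
    @ \oo --> r N / N`!%:R.
Proof.
under eq_fun do rewrite scaled_elementary.
have -> : r N / N`!%:R = \sum_(l < N.+1) ((l == N :> nat)%:R / N`!%:R) * r l.
  rewrite big_ord_recr /= eqxx big1 => [|l _]; first by rewrite add0r mul1r mulrC.
  by rewrite ltn_eqF ?mul0r.
apply: (@cvg_sum_seq R _ (index_enum 'I_N.+1) (fun l p =>
  ('C(p.*2.+1, l))%:R / p.*2.+1%:R ^+ N * r l)
         (fun l => (l == N :> nat)%:R / N`!%:R * r l)) => l _.
apply: cvgMl.
have lN : (l <= N)%N by rewrite -ltnS.
apply: (@cvg_comp _ _ _ (fun p => p.*2.+1) (fun M : nat => ('C(M, l))%:R / M%:R ^+ N : R));
  last exact: cvg_bin_expn lN.
(* Only the odd values [2p + 1] are used; they tend to infinity with [p]. *)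
by move=> A [q _ qA]; exists q => // p /= qp; apply: qA => /=; lia.
Qed.

Lemma limit_value :
  r N = (-1) ^+ (n + 1 + m./2) * pi ^+ (2 * m * n) / 2 ^+ (m - 2)
    * complex.Im (\sum_(e : signs m.-1 | sign_prod e == 1) @signed_sum R m e ^+ N).
Proof.
set U := \sum_(e : signs _ | _) _.
have DN : D N = 'i%C ^+ N * (4 * U).
  rewrite /D /U -sum_full_signs // mulr_sumr; apply: eq_bigr => b _.
  by rewrite coef_sign_poly_diag exprMn mulrCA.
have mE : m = (m./2).*2 by rewrite -{1}(odd_double_half m) (negbTE m_even).
(* This gives [m >= 2], so [m - 2] is a genuine subtraction. *)
have h0 : (0 < m./2)%N by lia.
have im : 'i%C ^+ m = (-1) ^+ m./2 :> C by rewrite {1}mE -mul2n exprM sqr_i.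
have im1 : 'i%C ^+ m.-1 = - 'i%C * (-1) ^+ m./2 :> C.
  by rewrite -im -{2}(prednK m_gt0) exprS mulrA mulNr -expr2 sqr_i opprK mul1r.
have iN : 'i%C ^+ N = (-1) ^+ m./2 :> C.
  have -> : (N = 2 * (m./2 * (2 * n)) + m)%N by lia.
  by rewrite exprD im exprM sqr_i mulnCA exprM sqrrN expr1n expr1n mul1r.
have e2 : 2 ^+ m = 4 * 2 ^+ (m - 2) :> C.
  have {1}-> : (m = 2 + (m - 2))%N by lia.
  by rewrite exprD; congr (_ * _); rewrite -natrX.
have sgn k : (-1) ^+ k * (-1) ^+ k = 1 :> C by rewrite -exprMn mulrNN mulr1 expr1n.
(* The power ['i ^ (m - 1)] in [K] leaves a factor ['i], and the real part of [- 'i * U] is the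
   imaginary part of [U]; the remaining sign is the [+ 1] in the exponent of -1. *)
set c : R := _ / _; suff -> : r N = complex.Re (c%:C * (- 'i%C * U)).
  by rewrite Re_realM; case: (U) => x y /=; congr (_ * _); ring.
congr complex.Re; rewrite DN; apply: (canLR (mulfK K_neq0)).
rewrite /c /K exprMn iN im im1 e2 fmorph_div rmorphM !rmorphXn rmorphN rmorph1 rmorph_nat.
rewrite !exprD expr1.
move: (sgn n) (sgn m./2); set s := _ ^+ n; set t := _ ^+ m./2 => ss tt.
set P := _ ^+ (2 * m * n); set q := 2 ^+ (m - 2).
have q0 : q != 0 by rewrite expf_neq0 ?pnatr_eq0.
transitivity ((s * s) * (t * t) * - ('i%C ^+ 2) * (P * (t * (4 * U)))).
  by rewrite ss tt sqr_i opprK !mul1r.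
by field.
Qed.
End Limit.


End FiniteSineProduct.

Theorem theorem2 (R : realType) (m n : nat) (hm : (0 < m)%N) (hn : (0 < n)%N)
    (hm_even : ~~ odd m) :
  zeta_rep R (2 * m) n =
  ((-1) ^+ (n + 1 + m./2) * pi ^+ (2 * m * n)
     / (2 ^+ (m - 2) * ((2 * m * n + m)`!)%:R)
   * complex.Im (\sum_(e : signs m.-1 | sign_prod e == 1)
          signed_sum R e ^+ (2 * m * n + m)))%:E.
Proof.
rewrite (zeta_rep_eq_lim _ _ _ _ (cvg_scaled_elementary R m n hm hm_even)).
rewrite limit_value //; congr (_%:E); field.
by rewrite expf_neq0 ?pnatr_eq0 ?(gtn_eqF (fact_gt0 _)).
Qed.
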